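(* Assume the setting and standing assumptions described in the context, and let $\lambda>0$. Let $f\in L^1_{\mathcal{J}}(\mathcal{V}')$, $g\in L^1_{\mathcal{J}}(\mathcal{Q}')$, let $(u,p)\in L^1_{\mathcal{J}}(\mathcal{V}\times\mathcal{Q})$ satisfy, for a.e. $t\in\mathcal{J}$ and all $(v,q)\in\mathcal{V}\times\mathcal{Q}$, $$\begin{aligned}a(u(t),v)+b(v,p(t))&=\langle f(t),v\rangle_{\mathcal{V}}+\int_0^t\big[k_1(t,s)a(u(s),v)+k_2(t,s)b(v,p(s))\big]ds,\\ b(u(t),q)-\lambda(p(t),q)_{\mathcal{Q}}&=\langle g(t),q\rangle_{\mathcal{Q}},\end{aligned}$$ and let $(u_h,p_h)\in L^1_{\mathcal{J}}(\mathcal{V}_h\times\mathcal{Q}_h)$ be the unique solution of the same two equations with $(u,p)$ replaced by $(u_h,p_h)$ and test functions $(v,q)\in\mathcal{V}_h\times\mathcal{Q}_h$. Then, for positive constants $C_{1u},C_{1p},C_{2u},C_{2p}$, $$\|u_h-u\|_{L^1_{\mathcal{J}}(\mathcal{V})}\le C_{1u}\inf_{v\in L^1_{\mathcal{J}}(\mathcal{V}_h)}\|u-v\|_{L^1_{\mathcal{J}}(\mathcal{V})}+C_{1p}\inf_{q\in L^1_{\mathcal{J}}(\mathcal{Q}_h)}\|p-q\|_{L^1_{\mathcal{J}}(\mathcal{Q})},$$ $$\|p_h-p\|_{L^1_{\mathcal{J}}(\mathcal{Q})}\le C_{2u}\inf_{v\in L^1_{\mathcal{J}}(\mathcal{V}_h)}\|u-v\|_{L^1_{\mathcal{J}}(\mathcal{V})}+C_{2p}\inf_{q\in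 L^1_{\mathcal{J}}(\mathcal{Q}_h)}\|p-q\|_{L^1_{\mathcal{J}}(\mathcal{Q})}.$$ Moreover, there exists a constant $C>0$, depending on $C_{iu}$ and $C_{ip}$, $i=1,2$, and uniform with respect to $\lambda$, such that $$\|u_h-u\|_{L^1_{\mathcal{J}}(\mathcal{V})}+\|p_h-p\|_{L^1_{\mathcal{J}}(\mathcal{Q})}\le C\Big(\inf_{v\in L^1_{\mathcal{J}}(\mathcal{V}_h)}\|u-v\|_{L^1_{\mathcal{J}}(\mathcal{V})}+\inf_{q\in L^1_{\mathcal{J}}(\mathcal{Q}_h)}\|p-q\|_{L^1_{\mathcal{J}}(\mathcal{Q})}\Big).$$
   Context: $\mathcal{V},\mathcal{Q}$ are real Hilbert spaces with duals $\mathcal{V}',\mathcal{Q}'$, duality pairings $\langle\cdot,\cdot\rangle_{\mathcal{V}},\langle\cdot,\cdot\rangle_{\mathcal{Q}}$, and $(\cdot,\cdot)_{\mathcal{Q}}$ the inner product of $\mathcal{Q}$; $\mathcal{J}=[0,T]$ with $T\in[0,\infty)$; $L^1_{\mathcal{J}}(\mathcal{B})$ denotes the Bochner space $L^1(\mathcal{J};\mathcal{B})$. $a:\mathcal{V}\times\mathcal{V}\to\mathbb{R}$ and $b:\mathcal{V}\times\mathcal{Q}\to\mathbb{R}$ are continuous bilinear forms; $a$ is symmetric, positive semi-definite, and coercive on $\mathcal{K}=\{v\in\mathcal{V}:b(v,q)=0\ \forall q\in\mathcal{Q}\}$. The kernels $k_1,k_2$ are continuous bounded real functions on the triangle $\{(t,s):0\le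 s\le t\le T\}$. Discrete spaces: $\mathcal{V}_h\subset\mathcal{V}$ and $\mathcal{Q}_h\subset\mathcal{Q}$ are finite-dimensional subspaces ($h$ a discretization parameter), $\mathcal{K}_h=\{v_h\in\mathcal{V}_h:b(v_h,q_h)=0\ \forall q_h\in\mathcal{Q}_h\}$, and there are $\alpha_*^0,\gamma_*^0>0$, independent of $h$, with $a(v,v)\ge\alpha_*^0\|v\|_{\mathcal{V}}^2$ for all $v\in\mathcal{K}_h$ and $c(q,q)\ge\gamma_*^0\|q\|_{\mathcal{Q}}^2$ for all $q\in\mathcal{Q}_h$, where $c(p,q)=\lambda(p,q)_{\mathcal{Q}}$ (so the latter holds automatically with $\gamma_*^0=\lambda$). The discrete inf-sup condition holds: there is $\beta_*>0$ such that $\sup_{v\in\mathcal{V}_h\setminus\{0\}}b(v,q)/\|v\|_{\mathcal{V}}\ge\beta_*\|q\|_{\mathcal{Q}}$ for all $q\in\mathcal{Q}_h$.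
   Formalization: The constant C is uniform in λ on every bounded range 0 < λ ≤ λ_max (so in particular as λ → 0) rather than over all λ > 0, since a single C for all λ > 0 fails: with a = 0, V = ℝ, Q = ℝ², Q_h = ℝ×{0}, b(v,q) = v(q₁+q₂), one gets C ≥ λ. *)

(* Defs.v *)
From HB Require Import structures.
From mathcomp Require Import all_boot all_order all_algebra.
From mathcomp Require Import sesquilinear.
From mathcomp Require Import all_classical all_reals all_analysis.

Set Implicit Arguments.
Unset Strict Implicit.
Unset Printing Implicit Defensive.

Import Order.TTheory GRing.Theory Num.Theory.
Import numFieldNormedType.Exports.

Local Open Scope classical_set_scope.
Local Open Scope ring_scope.

HB.mixin Record CompleteNormedModule_isHilbert (R : realType) V
    of CompleteNormedModule R V := {
  inner : V -> V -> R ;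
  innerC : forall x y, inner x y = inner y x ;
  inner_scalar : forall y, scalar (inner^~ y) ;
  inner_norm : forall x, inner x x = `|x| ^+ 2
}.

#[short(type="hilbertType")]
HB.structure Definition Hilbert (R : realType) :=
  {V of CompleteNormedModule_isHilbert R V & CompleteNormedModule R V}.

Section Functional.
Context {R : realType}.

Definition finite_dim_subspace (V : lmodType R) (S : set V) : Prop :=
  exists n (e : 'I_n -> V),
    S = range (fun c : 'I_n -> R => \sum_(i < n) c i *: e i).

Definition coercive_on (V : normedModType R) (a : V -> V -> R) (K : set V)
    (alpha : R) : Prop :=
  forall v, K v -> alpha * `|v| ^+ 2 <= a v v.

Definition form_ker (V Q : Type) (b : V -> Q -> R) (S : set V) (M : set Q) :
    set V :=
  [set v | S v /\ forall q, M q -> b v q = 0].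

(* The set below is bounded above when [b] is continuous, so [sup] is the
   actual supremum; it is 0 in the degenerate case [S = [set 0]]. *)
Definition inf_sup (V Q : normedModType R) (b : V -> Q -> R) (S : set V)
    (M : set Q) (beta : R) : Prop :=
  forall q, M q ->
    beta * `|q| <= sup [set b v q / `|v| | v in [set v | S v /\ v != 0]].

Definition dual_space (V : normedModType R) : set (V -> R) :=
  [set l : V -> R | scalar l /\ continuous l].

Definition dual_norm (V : normedModType R) (l : V -> R) : R :=
  sup [set `|l v| | v in [set v : V | `|v| <= 1]].

Definition triangle (T : R) : set (R * R) :=
  [set z | 0 <= z.2 /\ z.2 <= z.1 /\ z.1 <= T].

Definition kernel_hyp (T : R) (k : R -> R -> R) : Prop :=
  {within triangle T, continuous (fun z : R * R => k z.1 z.2)} /\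
  [bounded k z.1 z.2 | z in triangle T].

Definition simple_fun (B : Type) (S : set B) (phi : R -> B) : Prop :=
  [/\ forall t, S (phi t), finite_set (range phi)
    & forall x, measurable (phi @^-1` [set x])].

Definition L1norm (T : R) (B : Type) (N : B -> R) (u : R -> B) : \bar R :=
  (\int[lebesgue_measure]_(t in `[0%R, T]) (N (u t))%:E)%E.

(* [bochner_L1 T N S] is L^1([0, T]; S) for a subspace [S] of [B] on which [N]
   is a norm.  Its elements are representatives: strong measurability is
   required with respect to the Borel sets and at every point of [0, T].  Any
   almost everywhere limit of simple functions coincides almost everywhere
   with such a function, so that every class of the usual Bochner space is
   represented. *)
Definition bochner_L1 (T : R) (B : zmodType) (N : B -> R) (S : set B) :
    set (R -> B) :=
  [set u | [/\ forall t, t \in `[0, T] -> S (u t),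
      exists phi : nat -> R -> B, (forall n, simple_fun S (phi n)) /\
        forall t, t \in `[0, T] ->
          N (u t - phi n t) @[n --> \oo] --> (0 : R)
    & (L1norm T N u < +oo)%E]].

Definition L1 (T : R) (V : normedModType R) (S : set V) : set (R -> V) :=
  bochner_L1 T (fun x : V => `|x|) S.

Definition L1dual (T : R) (V : normedModType R) : set (R -> V -> R) :=
  bochner_L1 T (@dual_norm V) (@dual_space V).

Definition L1dist (T : R) (V : normedModType R) (u v : R -> V) : \bar R :=
  L1norm T (fun x : V => `|x|) (fun t => u t - v t).

Definition best_approx (T : R) (V : normedModType R) (S : set V)
    (u : R -> V) : \bar R :=
  ereal_inf [set L1dist T u v | v in L1 T S].

End Functional.

(* Trial and test spaces are [S] and [M]. *)
Definition volterra_solution (R : realType) (V Q : hilbertType R) (T : R)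
    (a : V -> V -> R) (b : V -> Q -> R) (k1 k2 : R -> R -> R) (lambda : R)
    (f : R -> V -> R) (g : R -> Q -> R) (S : set V) (M : set Q)
    (u : R -> V) (p : R -> Q) : Prop :=
  [/\ L1 T S u, L1 T M p &
    {ae lebesgue_measure, forall t : R, t \in `[0, T] ->
      forall v q, S v -> M q ->
        a (u t) v + b v (p t) =
          f t v + \int[lebesgue_measure]_(s in `[0, t])
                    (k1 t s * a (u s) v + k2 t s * b v (p s)) /\
        b (u t) q - lambda * inner (p t) q = g t q}].

(* Main.v *)
Require Import Defs.
From HB Require Import structures.
From mathcomp Require Import all_boot all_order all_algebra.
From mathcomp Require Import sesquilinear.
From mathcomp Require Import all_classical all_reals all_analysis.
From mathcomp Require Import measurable_realfun ring lra.

Set Implicit Arguments.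
Unset Strict Implicit.
Unset Printing Implicit Defensive.

Import Order.TTheory GRing.Theory Num.Theory.
Import numFieldNormedType.Exports.

Local Open Scope classical_set_scope.
Local Open Scope ring_scope.

(* Fix [v] and [q] with values in the discrete spaces.  By Galerkin
   orthogonality, [uh - v] and [ph - q] solve, at almost every time, a discrete
   saddle point problem whose data are bounded by [|u - v| + |p - q|] plus a
   constant times the integral over [[0, t]] of the error
   [|uh - u| + |ph - p|].  The saddle point problem is stable uniformly in
   [0 < lambda <= lmax]: the inf-sup condition bounds the pressure and lets one
   correct the velocity into the discrete kernel, where [a] is coercive.  The
   L^1 form of Gronwall's lemma then absorbs the memory term. *)

(** * Linear forms, Gram systems and finite-dimensional subspaces *)

Lemma scalar0 (R : realType) (V : lmodType R) (l : V -> R) :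
  scalar l -> l 0 = 0.
Proof.
move=> lin; have := lin 1 0 0; rewrite scaler0 addr0 mul1r.
by move=> /esym/eqP; rewrite -subr_eq0 addrK => /eqP.
Qed.

Lemma scalarB (R : realType) (V : lmodType R) (l : V -> R) x y :
  scalar l -> l (x - y) = l x - l y.
Proof. by move=> lin; rewrite addrC -scaleN1r lin mulN1r addrC. Qed.

Lemma scalar_sum (R : realType) (V : lmodType R) (l : V -> R) n (c : 'I_n -> R)
    (w : 'I_n -> V) :
  scalar l -> l (\sum_i c i *: w i) = \sum_i c i * l (w i).
Proof.
move=> lin; elim/big_rec2: _ => [|i y x _ <-]; last by rewrite lin.
exact: scalar0.
Qed.

Lemma inner_suml (R : realType) (V : hilbertType R) n (c : 'I_n -> R)
    (w : 'I_n -> V) v :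
  inner (\sum_i c i *: w i) v = \sum_i c i * inner (w i) v.
Proof. by rewrite (scalar_sum _ _ (inner_scalar v)). Qed.

Lemma inner_sumr (R : realType) (V : hilbertType R) n (c : 'I_n -> R)
    (w : 'I_n -> V) v :
  inner v (\sum_i c i *: w i) = \sum_i c i * inner v (w i).
Proof.
by rewrite innerC inner_suml; apply: eq_bigr => i _; rewrite innerC.
Qed.

(** The quadratic polynomial [t |-> a (t *: y + x) (t *: y + x)] is nonnegative. As [a] is only
    semi-definite, its leading coefficient [a y y] may vanish for a nonzero [y]. *)
Lemma psd_cauchy_schwarz (R : realType) (V : lmodType R) (a : V -> V -> R) :
  (forall y, scalar (a^~ y)) -> (forall x y, a x y = a y x) ->
  (forall x, 0 <= a x x) ->
  forall x y, a x y ^+ 2 <= a x x * a y y.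
Proof.
move=> lin sym psd x y.
have key t : 0 <= t ^+ 2 * a y y + 2 * t * a x y + a x x.
  have := psd (t *: y + x); rewrite lin (sym y) (sym x) !lin.
  by rewrite (sym y x); congr (_ <= _); ring.
have [y0|y0] := eqVneq (a y y) 0.
  rewrite y0 mulr0; have [->|xy0] := eqVneq (a x y) 0; first by rewrite expr0n.
  (* With [a y y = 0] the polynomial is affine; at this [t] it equals -1 if its slope is nonzero, a
     contradiction. *)
  have := key (- (a x x + 1) / (2 * a x y)); rewrite y0 mulr0 add0r.
  rewrite (_ : 2 * _ * _ + _ = -1); last by field.
  by rewrite ler0N1.
have ygt0 : 0 < a y y by rewrite lt_neqAle eq_sym y0 psd.
(* This [t] minimizes the polynomial. *)
have := key (- a x y / a y y).
rewrite (_ : _ + _ + _ = (a x x * a y y - a x y ^+ 2) / a y y); last by field.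
by rewrite pmulr_lge0 ?invr_gt0// subr_ge0.
Qed.

Lemma inner_le_norm (R : realType) (V : hilbertType R) (x y : V) :
  `|inner x y| <= `|x| * `|y|.
Proof.
have := psd_cauchy_schwarz (@inner_scalar _ V) innerC _ x y.
rewrite !inner_norm -exprMn -real_normK ?num_real//.
by rewrite ler_pXn2r ?nnegrE ?mulr_ge0//; apply => z; rewrite inner_norm.
Qed.

(** The [w i] may be linearly dependent, so the data [l] must respect their linear relations. This
    suffices: a vector [c] in the kernel of the Gram matrix [G] makes [\sum_i c i *: w i] of norm
    zero, hence is such a relation, so the data are orthogonal to that kernel and lie in the row
    space of [G]. *)
Lemma gram_solve (R : realType) (V : hilbertType R) n (w : 'I_n -> V)
    (l : 'I_n -> R) :
  (forall c : 'I_n -> R, \sum_i c i *: w i = 0 -> \sum_i c i * l i = 0) ->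
  exists c : 'I_n -> R,
    forall i, inner (\sum_j c j *: w j) (w i) = l i.
Proof.
move=> hl; pose G := \matrix_(i, j) inner (w i) (w j).
pose r := \row_i l i.
have /submxP[D rD] : (r <= G)%MS.
  rewrite submxE; apply/eqP/matrixP => i k; rewrite !mxE.
  pose c j := cokermx G j k.
  under eq_bigr do rewrite mxE mulrC -/(c _); apply: hl.
  apply/eqP; rewrite -normr_eq0 -(sqrf_eq0 `|_|) -inner_norm.
  rewrite inner_suml; apply/eqP; apply: big1 => j _; rewrite inner_sumr.
  have := mulmx_coker G => /matrixP/(_ j k); rewrite mxE [RHS]mxE => h.
  rewrite (_ : (\sum__ _) = 0) ?mulr0// -[RHS]h.
  by apply: eq_bigr => s _; rewrite mxE mulrC.
exists (D 0) => i; rewrite inner_suml.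
have := congr1 (fun A : 'rV_n => A 0 i) rD; rewrite !mxE => ->.
by apply: eq_bigr => j _; rewrite mxE.
Qed.

Lemma finite_dim_subspaceB (R : realType) (V : lmodType R) (S : set V) x y :
  finite_dim_subspace S -> S x -> S y -> S (x - y).
Proof.
move=> [n [e ->]] [c _ <-] [d _ <-]; exists (fun i => c i - d i) => //.
by rewrite -sumrB; apply: eq_bigr => i _; rewrite scalerBl.
Qed.

Lemma finite_dim_subspace0 (R : realType) (V : lmodType R) (S : set V) :
  finite_dim_subspace S -> S 0.
Proof.
move=> [n [e ->]]; exists (fun=> 0) => //.
by apply: big1 => i _; rewrite scale0r.
Qed.

(** * The discrete inf-sup condition and stability of the saddle point problem *)

Lemma inf_sup_le (R : realType) (V Q : normedModType R) (b : V -> Q -> R)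
    (S : set V) (M : set Q) (beta N : R) q :
  inf_sup b S M beta -> M q -> 0 <= N ->
  (forall w, S w -> b w q <= N * `|w|) -> beta * `|q| <= N.
Proof.
move=> bS Mq N0 bN; apply: (le_trans (bS _ Mq)).
(* If [S] has no nonzero vector, [A] is empty and [sup] takes its default value 0, which is at most
   [N]. *)
set A := (X in sup X); have [->|/set0P A0] := eqVneq A set0.
  by rewrite sup0.
apply: ge_sup => // _ [w [Sw w0] <-].
by rewrite ler_pdivrMr ?normr_gt0// bN.
Qed.

(** The vector [x1] is the part of [x] orthogonal to the discrete kernel. It represents [b ^~ r] on
    [S] for some [r] in [M], so [|x1|^2 = b x1 r = b x r <= N * |r|], while the inf-sup condition
    gives [beta * |r| <= |x1|]. *)
Lemma inf_sup_lift (R : realType) (V Q : hilbertType R)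
    (b : {bilinear V -> Q -> R | *%R & *%R}) (S : set V) (M : set Q)
    (beta : R) :
  finite_dim_subspace S -> finite_dim_subspace M -> 0 < beta ->
  inf_sup b S M beta ->
  forall x N, S x -> 0 <= N -> (forall r, M r -> `|b x r| <= N * `|r|) ->
  exists2 x1, S x1 &
    (forall r, M r -> b x1 r = b x r) /\ beta * `|x1| <= N.
Proof.
move=> [n [e ->]] [m [f ->]] beta0 bSM x N [cx _ xE] N0 xN.
have linl q : scalar (b^~ q) by move=> k u v; rewrite linearPl.
have linr v : scalar (b v) by move=> k u w; rewrite linearPr.
(* The Riesz representatives in [S] of the functionals [b ^~ (f j)]. *)
have /choice[c hc] : forall j, exists c : 'I_n -> R,
    forall i, inner (\sum_k c k *: e k) (e i) = b (e i) (f j).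
  move=> j; apply: gram_solve => c c0.
  by rewrite -(scalar_sum _ _ (linl _)) c0 linear0l.
pose w j := \sum_k c j k *: e k.
have wE j v : range (fun c : 'I_n -> R => \sum_(i < n) c i *: e i) v ->
    inner v (w j) = b v (f j).
  move=> [d _ <-]; rewrite (scalar_sum _ _ (linl _)).
  rewrite inner_suml.
  by apply: eq_bigr => i _; rewrite innerC hc.
(* The data [b x (f j)] equal [inner x (w j)], so they respect all relations among the [w j]; the
   solution gives the orthogonal projection [x1] of [x] on their span. *)
have [|d hd] := @gram_solve _ _ _ w (fun j => b x (f j)).
  move=> d d0; transitivity (inner x (\sum_j d j *: w j)).
    rewrite inner_sumr; apply: eq_bigr => j _.
    by rewrite wE//; exists cx.
  by rewrite d0 innerC (scalar0 (inner_scalar x)).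
set x1 := \sum_j d j *: w j in hd.
pose r := \sum_j d j *: f j.
have Sx1 : range (fun c : 'I_n -> R => \sum_(i < n) c i *: e i) x1.
  exists (fun k => \sum_j d j * c j k) => //.
  rewrite /x1 /w; under [RHS]eq_bigr do rewrite scaler_sumr.
  rewrite exchange_big; apply: eq_bigr => k _ /=; rewrite scaler_suml.
  by apply: eq_bigr => j _; rewrite scalerA.
have x1b v : range (fun c : 'I_n -> R => \sum_(i < n) c i *: e i) v ->
    inner x1 v = b v r.
  move=> Sv; rewrite inner_suml.
  by rewrite (scalar_sum _ _ (linr _)); apply: eq_bigr => j _; rewrite innerC wE.
have x1x t : range (fun c : 'I_m -> R => \sum_(i < m) c i *: f i) t -> b x1 t = b x t.
  move=> [s _ <-]; rewrite !(scalar_sum _ _ (linr _)).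
  by apply: eq_bigr => j _; rewrite -hd wE.
exists x1 => //; split => //.
have Mr : range (fun c : 'I_m -> R => \sum_(i < m) c i *: f i) r by exists d.
have rx1 : beta * `|r| <= `|x1|.
  apply: (inf_sup_le bSM) => // v Sv; rewrite -x1b//.
  exact: le_trans (ler_norm _) (inner_le_norm _ _).
have x1N : `|x1| ^+ 2 <= N * `|r|.
  by rewrite -inner_norm x1b// x1x// (le_trans (ler_norm _))// xN.
have [->|x10] := eqVneq x1 0; first by rewrite normr0 mulr0.
rewrite -(ler_pM2r (_ : 0 < `|x1|)) ?normr_gt0// -mulrA -expr2.
apply: (@le_trans _ _ (beta * (N * `|r|))); first by rewrite ler_wpM2l// ltW.
by rewrite mulrCA ler_wpM2l.
Qed.

(** Everything is bounded in terms of [P = F + G] and the energy [s], the square root of [a x x]: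
    [y] by the inf-sup condition, the lift [x1] by [inf_sup_lift], and [x - x1] by coercivity on the
    discrete kernel. Testing with [x] and [y] bounds [s ^+ 2] by [P] times these norms, which bounds
    [s] by [P]. The parameter [lambda] enters only through its sign and through [lmax], so [C] is
    uniform in it and in the spaces. *)
Lemma saddle_point_stability (R : realType) (V Q : hilbertType R)
    (a : {bilinear V -> V -> R | *%R & *%R})
    (b : {bilinear V -> Q -> R | *%R & *%R}) (m alpha beta lmax : R) :
  (forall v w, a v w = a w v) -> (forall v, 0 <= a v v) ->
  0 <= m -> (forall v, a v v <= m ^+ 2 * `|v| ^+ 2) ->
  0 < alpha -> 0 < beta -> 0 < lmax ->
  exists2 C, 0 < C & forall (S : set V) (M : set Q) (lambda F G : R) x y,
    finite_dim_subspace S -> finite_dim_subspace M ->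
    coercive_on a (form_ker b S M) alpha -> inf_sup b S M beta ->
    0 < lambda <= lmax -> 0 <= F -> 0 <= G -> S x -> M y ->
    (forall w, S w -> `|a x w + b w y| <= F * `|w|) ->
    (forall r, M r -> `|b x r - lambda * inner y r| <= G * `|r|) ->
    `|x| + `|y| <= C * (F + G).
Proof.
move=> asym apsd m0 am alpha0 beta0 lmax0.
pose k := Num.sqrt alpha; have k0 : 0 < k by rewrite sqrtr_gt0.
(* Relative to [P + s], [e] will bound [|y|], [d] will bound [|x1|], and the second summand of [c]
   will bound [|x|]. *)
pose e := beta^-1 * (1 + m).
pose d := beta^-1 * (1 + lmax * e).
pose c := e + (k^-1 + (k^-1 * m + 1) * d).
have bi0 : 0 < beta^-1 by rewrite invr_gt0.
have ki0 : 0 < k^-1 by rewrite invr_gt0.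
have e0 : 0 < e by rewrite mulr_gt0// ltr_wpDr.
have d0 : 0 < d by rewrite mulr_gt0// ltr_wpDr// mulr_ge0// ltW.
have c0 : 0 < c.
  have := mulr_gt0 ki0 d0; have := mulr_ge0 m0 (ltW (mulr_gt0 ki0 d0)).
  rewrite /c; lra.
exists (2 * c * (2 * c + 2)); first nra.
move=> S M lambda F G x y Sfin Mfin acoer bSM /andP[l0 ll] F0 G0 Sx My hF hG.
have [x1 Sx1 [bx1 x1le]] : exists2 x1, S x1 &
    (forall r, M r -> b x1 r = b x r) /\ beta * `|x1| <= G + lambda * `|y|.
  apply: inf_sup_lift => //; first by rewrite addr_ge0// mulr_ge0// ltW.
  move=> r Mr; rewrite -[b x r](subrK (lambda * inner y r)) mulrDl.
  rewrite (le_trans (ler_normD _ _))// lerD ?hG// normrM gtr0_norm// -mulrA.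
  by rewrite ler_pM2l// inner_le_norm.
set s := Num.sqrt (a x x).
have s0 : 0 <= s by exact: sqrtr_ge0.
have sE : s ^+ 2 = a x x by rewrite sqr_sqrtr.
(* Cauchy-Schwarz for [a] leaves the energy [s] in place of [|x|], which is not yet controlled off
   the kernel. *)
have acs w : `|a x w| <= s * (m * `|w|).
  rewrite -(@ler_pXn2r _ 2)// ?nnegrE ?mulr_ge0// real_normK ?num_real//.
  have lina z : scalar (a^~ z) by move=> ? ? ?; rewrite linearPl.
  apply: (le_trans (psd_cauchy_schwarz lina asym apsd _ _)).
  by rewrite !exprMn sE ler_wpM2l.
have yle : beta * `|y| <= F + m * s.
  apply: (inf_sup_le bSM) => //; first by rewrite addr_ge0// mulr_ge0.
  move=> w Sw; have := hF w Sw; have := acs w.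
  rewrite !ler_norml => /andP[? ?] /andP[? ?]; lra.
(* Subtracting the two equations tested with [x] and [y] cancels [b x y]; the term
   [lambda * |y| ^+ 2] has the favourable sign and is dropped. *)
have energy : s ^+ 2 <= F * `|x| + G * `|y|.
  have := hF x Sx; have := hG y My; rewrite inner_norm !ler_norml sE.
  have : 0 <= lambda * `|y| ^+ 2 by rewrite mulr_ge0 ?sqr_ge0// ltW.
  move=> ? /andP[? ?] /andP[? ?]; lra.
(* Triangle inequality for the seminorm of [a], combined with coercivity at [x - x1]. *)
have x0le : k * `|x - x1| <= s + m * `|x1|.
  rewrite -(@ler_pXn2r _ 2)// ?nnegrE ?addr_ge0 ?mulr_ge0// ?(ltW k0)//.
  have Kx : form_ker b S M (x - x1).
    split; first exact: finite_dim_subspaceB.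
    by move=> q Mq; rewrite linearBl bx1// subrr.
  rewrite exprMn sqr_sqrtr; last exact: ltW.
  apply: (le_trans (acoer _ Kx)).
  rewrite linearBl !linearBr/= (asym x1 x) -sE.
  have := am x1; have := acs x1; rewrite ler_norml => /andP[? ?] ?; nra.
set P := F + G.
have P0 : 0 <= P by rewrite addr_ge0.
have P0s : 0 <= P + s by rewrite addr_ge0.
have yle' : `|y| <= e * (P + s).
  rewrite /e -mulrA ler_pdivlMl// (le_trans yle)// /P.
  have := mulr_ge0 m0 P0; rewrite /P; lra.
have x1le' : `|x1| <= d * (P + s).
  rewrite /d -mulrA ler_pdivlMl// (le_trans x1le)//.
  have : lambda * `|y| <= lmax * (e * (P + s)) by rewrite ler_pM// ltW.
  rewrite /P; lra.
have xle : `|x| <= (k^-1 + (k^-1 * m + 1) * d) * (P + s).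
  have : `|x - x1| <= k^-1 * (s + m * (d * (P + s))).
    rewrite ler_pdivlMl// (le_trans x0le)// lerD2l ler_wpM2l//.
  have : `|x| <= `|x - x1| + `|x1| by rewrite -{1}(subrK x1 x) ler_normD.
  have := mulr_ge0 (ltW ki0) P0; lra.
have xyle : `|x| + `|y| <= c * (P + s) by rewrite /c mulrDl addrC lerD.
have nx : `|x| <= c * (P + s) by apply: le_trans xyle; rewrite lerDl.
have ny : `|y| <= c * (P + s) by apply: le_trans xyle; rewrite lerDr.
have s2 : s ^+ 2 <= 2 * c * P * (P + s).
  apply: (le_trans energy).
  have := ler_wpM2l F0 nx; have := ler_wpM2l G0 ny.
  have := mulr_ge0 (mulr_ge0 (ltW c0) P0) P0s; rewrite /P; lra.
(* If [s > (2 * c + 1) * P], then [s ^+ 2 > 2 * c * P * s + P * s], and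
   [P * s >= (2 * c + 1) * P ^+ 2]; this contradicts [s2]. *)
have sP : s <= (2 * c + 1) * P.
  rewrite leNgt; apply/negP => sgt.
  have cP0 : 0 <= (2 * c + 1) * P by rewrite mulr_ge0// addr_ge0// mulr_ge0// ltW.
  have := mulr_gt0 (le_lt_trans cP0 sgt) (etrans (subr_gt0 _ _) sgt).
  have := mulr_ge0 P0 (ltW (etrans (subr_gt0 _ _) sgt)).
  have := sqr_ge0 P; lra.
apply: (le_trans xyle).
have := ler_wpM2l (ltW c0) sP; have := mulr_ge0 (ltW c0) P0.
have := mulr_ge0 (ltW c0) (mulr_ge0 (ltW c0) P0); lra.
Qed.

(** * Monotonicity of integrals and Gronwall's lemma in L^1 *)

Lemma ae_le_Rintegral d (X : measurableType d) (R : realType)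
    (mu : {measure set X -> \bar R}) (D : set X) (f g : X -> R) :
  measurable D -> mu.-integrable D (EFin \o f) -> mu.-integrable D (EFin \o g) ->
  (forall x, D x -> 0 <= f x) -> (forall x, D x -> 0 <= g x) ->
  {ae mu, forall x, D x -> f x <= g x} ->
  \int[mu]_(x in D) f x <= \int[mu]_(x in D) g x.
Proof.
move=> mD fi gi f0 g0 fg; apply: fine_le; [exact: integrable_fin_num..|].
apply: ae_ge0_le_integral => //.
- exact: (measurable_int mu).
- exact: (measurable_int mu).
Qed.

Lemma subset_Rintegral d (X : measurableType d) (R : realType)
    (mu : {measure set X -> \bar R}) (A D : set X) (f : X -> R) :
  measurable A -> measurable D -> A `<=` D -> mu.-integrable D (EFin \o f) ->
  (forall x, D x -> 0 <= f x) ->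
  \int[mu]_(x in A) f x <= \int[mu]_(x in D) f x.
Proof.
move=> mA mD AD fi f0.
apply: fine_le; [|exact: integrable_fin_num|].
  by apply: integrable_fin_num => //; exact: integrableS fi.
apply: ge0_subset_integral => //.
exact: (measurable_int mu).
Qed.

(* With [B * T <= N / 2], the integrals [S x] of [E] over [[0, x]] satisfy
   [S ((j + 1) T / N) <= 2 S (j T / N) + 2 G]. *)
Lemma gronwall_L1 (R : realType) (T B : R) : 0 <= T -> 0 <= B ->
  exists2 C, 0 < C & forall E g : R -> R,
    lebesgue_measure.-integrable `[0, T] (EFin \o E) ->
    lebesgue_measure.-integrable `[0, T] (EFin \o g) ->
    (forall t, t \in `[0, T] -> 0 <= E t) ->
    (forall t, t \in `[0, T] -> 0 <= g t) ->
    {ae lebesgue_measure, forall t, t \in `[0, T] ->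
      E t <= g t + B * \int[lebesgue_measure]_(s in `[0, t]) E s} ->
    \int[lebesgue_measure]_(t in `[0, T]) E t <=
    C * \int[lebesgue_measure]_(t in `[0, T]) g t.
Proof.
move=> T0 B0; pose N := (Num.bound (2 * B * T)).+1.
exists (2 ^+ N.+1); first by rewrite exprn_gt0.
move=> E g Ei gi E0 g0 Eg.
set G := (X in _ * X).
pose S x := \int[@lebesgue_measure R]_(s in `[0, x]) E s.
have Si x : x <= T -> lebesgue_measure.-integrable `[0, x] (EFin \o E).
  by move=> xT; apply: integrableS Ei => //; apply: subset_itvl; rewrite bnd_simp.
have S0 x : x <= T -> 0 <= S x.
  move=> xT; apply: Rintegral_ge0 => t; rewrite /= in_itv/= => /andP[t0 tx].
  by rewrite E0// in_itv/= t0 (le_trans tx).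
have Smono x y : x <= y -> y <= T -> S x <= S y.
  move=> xy yT; apply: subset_Rintegral => //; last 2 first.
  - exact: Si.
  - move=> t; rewrite /= in_itv/= => /andP[t0 ty].
    by rewrite E0// in_itv/= t0 (le_trans ty).
  by apply: subset_itvl; rewrite bnd_simp.
have G0 : 0 <= G by apply: Rintegral_ge0 => t /g0.
(* On []c, d]] the memory term is at most [B * S d] by monotonicity of [S], so [S d - S c <= G + B *
   (d - c) * S d <= G + S d / 2]. *)
have step c d : 0 <= c -> c <= d -> d <= T -> B * (d - c) <= 2^-1 ->
    S d <= 2 * S c + 2 * G.
  move=> c0 cd dT Bcd.
  have sub : `]c, d] `<=` `[0, T].
    by apply: subset_itv; rewrite bnd_simp.
  have ki : lebesgue_measure.-integrable `]c, d] (EFin \o cst (B * S d)).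
    apply/integrableP; split; first exact/measurable_EFinP/measurable_cst.
    rewrite (eq_integral (cst `|B * S d|%:E))//.
    rewrite integral_cst//= lebesgue_measure_itv/=.
    by case: ifPn => _; rewrite ?mule0// -EFinB -EFinM ltry.
  have gi' : lebesgue_measure.-integrable `]c, d] (EFin \o g) by exact: integrableS gi.
  have : S d - S c <= \int[@lebesgue_measure R]_(t in `]c, d]) (g t + B * S d).
    rewrite /S Rintegral_itvB ?bnd_simp//; last exact: Si.
    apply: ae_le_Rintegral => //.
    - exact: integrableS Ei.
    - by rewrite -/(S d); exact: (integrableD _ gi' ki).
    - by move=> x /sub/E0.
    - by move=> x /sub/g0 ?; rewrite addr_ge0// mulr_ge0// S0.
    - move: Eg; apply: filterS.
        exact: (ae_filter_ringOfSetsType lebesgue_measure).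
      move=> t Et tcd.
      apply: (le_trans (Et (sub _ tcd))).
      rewrite lerD2l ler_wpM2l// Smono//.
      by move: tcd; rewrite /= in_itv/= => /andP[].
  rewrite RintegralD// Rintegral_cst//=.
  rewrite lebesgue_measure_itv/= lte_fin.
  have -> : fine (if (c < d)%R then d%:E - c%:E else 0)%E = d - c.
    by case: ltP => // dc; rewrite (@le_anti _ _ c d) ?cd ?subrr.
  have : \int[@lebesgue_measure R]_(t in `]c, d]) g t <= G by exact: subset_Rintegral.
  have := ler_wpM2l (S0 d dT) Bcd; lra.
have NT : 0 < N%:R :> R by rewrite ltr0n.
(* The factor [2 ^+ j.+1 - 2] solves the recurrence [x' = 2 * x + 2] from 0, and [S 0 = 0] as an
   integral over a point. At [j = N] the node is [T]. *)
have iter j : (j <= N)%N -> S (j%:R * T / N%:R) <= (2 ^+ j.+1 - 2) * G.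
  elim: j => [_|j IH jN].
    by rewrite !mul0r /S set_itv1 Rintegral_set1 expr1 subrr mul0r.
  have jN' := ltnW jN.
  apply: (le_trans (step (j%:R * T / N%:R) _ _ _ _ _)).
  - by rewrite divr_ge0 ?mulr_ge0 ?ler0n.
  - by rewrite ler_pM2r ?invr_gt0// ler_wpM2r// ler_nat.
  - by rewrite ler_pdivrMr// mulrC ler_wpM2l// ler_nat.
  - rewrite -mulrBl -mulrBl -natrB// subSnn mul1r mulrA ler_pdivrMr//.
    rewrite -(ler_pM2l (ltr0n R 2)) !mulrA mulfV// mul1r.
    rewrite (le_trans (ltW (archi_boundP _)))// ?mulr_ge0//.
    by rewrite ler_nat.
  - by rewrite exprS; have := IH jN'; lra.
have := iter N (leqnn N); rewrite mulrAC mulfV ?gt_eqF// mul1r => /le_trans; apply.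
by rewrite ler_wpM2r// lerBlDr lerDl.
Qed.

(** * Measurability and integrability of Bochner functions *)

Lemma simple_fun_measurable (R : realType) (B : Type) (S : set B) (phi : R -> B)
    (F : B -> R) (D : set R) :
  simple_fun S phi -> measurable_fun D (F \o phi).
Proof.
move=> [_ phifin mphi]; apply: (measurable_funS measurableT) => // _ Y mY.
(* The range is finite, so the preimage is a finite union of level sets, whatever [F] is. *)
rewrite setTI (_ : _ @^-1` _ =
    \bigcup_(x in range phi `&` F @^-1` Y) phi @^-1` [set x]).
  apply: fin_bigcup_measurable; first exact: sub_finite_set phifin.
  by move=> x _; exact: mphi.
apply/seteqP; split => [t /= Yt|t [x [_ Yx] /= ->//]].
by exists (phi t) => //; split => //; exists t.
Qed.

Lemma simple_funB (R : realType) (V : zmodType) (S S' : set V)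
    (phi psi : R -> V) :
  simple_fun S phi -> simple_fun S' psi ->
  simple_fun setT (fun t => phi t - psi t).
Proof.
move=> [_ phifin mphi] [_ psifin mpsi]; split => //.
  apply: sub_finite_set (finite_image2 (fun x y => x - y) phifin psifin).
  by move=> _ [t _ <-]; exists (phi t); [exists t|exists (psi t); [exists t|]].
move=> x; rewrite (_ : _ @^-1` _ =
    \bigcup_(z in range psi) (phi @^-1` [set x + z] `&` psi @^-1` [set z])).
  by apply: fin_bigcup_measurable => // z _; exact: measurableI.
apply/seteqP; split => [t /= <-|t [z _ [/= -> ->]]]; last by rewrite addrK.
by exists (psi t); [exists t|split => //=; rewrite subrK].
Qed.

Lemma strongly_measurable_comp (R : realType) (V : normedModType R) (T : R)
    (S : set V) (u : R -> V) (F : V -> R) :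
  (exists phi : nat -> R -> V, (forall n, simple_fun S (phi n)) /\
    forall t, t \in `[0, T] -> `|u t - phi n t| @[n --> \oo] --> (0 : R)) ->
  continuous F -> measurable_fun `[0, T] (F \o u).
Proof.
move=> [phi [phis phiu]] cF.
apply: (@measurable_fun_cvg _ _ _ _ (fun n => F \o phi n)).
  by move=> n; exact: simple_fun_measurable (phis n).
move=> t tT; have := phiu t tT => /norm_cvg0 phit.
have phiut : phi n t @[n --> \oo] --> u t.
  rewrite -[X in _ --> X]subr0 (_ : phi^~ t = fun n => u t - (u t - phi n t)).
    by apply: cvgB => //; exact: cvg_cst.
  by apply/funext => n; rewrite subKr.
exact: cvg_comp phiut (cF (u t)).
Qed.

Lemma L1_integrable_norm (R : realType) (V : normedModType R) (T : R)
    (S : set V) (u : R -> V) :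
  L1 T S u -> lebesgue_measure.-integrable `[0, T] (EFin \o (fun t => `|u t|)).
Proof.
move=> u1; apply/integrableP; split.
  apply/measurable_EFinP.
  by case: u1 => _ /strongly_measurable_comp + _; apply; exact: norm_continuous.
case: u1 => _ _; rewrite /L1norm; apply: le_lt_trans.
by under eq_integral do rewrite /= normr_id.
Qed.

Lemma L1B (R : realType) (V : normedModType R) (T : R) (S S' : set V)
    (u v : R -> V) :
  L1 T S u -> L1 T S' v -> L1 T setT (fun t => u t - v t).
Proof.
move=> u1 v1; have [_ [phi [phis phiu]] _] := u1.
have [_ [psi [psis psiv]] _] := v1.
have uv : exists phi : nat -> R -> V, (forall n, simple_fun setT (phi n)) /\
    forall t, t \in `[0, T] ->
      `|u t - v t - phi n t| @[n --> \oo] --> (0 : R).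
  exists (fun n t => phi n t - psi n t); split.
    by move=> n; exact: simple_funB (phis n) (psis n).
  move=> t tT; rewrite -(@normr0 _ V).
  apply: (@continuous_cvg _ _ _ _ _ _ (@Num.norm _ V)); first exact: norm_continuous.
  rewrite (_ : (fun n => _) = fun n => (u t - phi n t) - (v t - psi n t)).
    rewrite -(subr0 0); apply: cvgB; first exact: norm_cvg0 (phiu t tT).
    exact: norm_cvg0 (psiv t tT).
  by apply/funext => n; rewrite opprD addrACA -opprD.
split => //.
have /integrableP[muv] : lebesgue_measure.-integrable `[0, T]
    ((EFin \o (fun t => `|u t|)) \+ (EFin \o (fun t => `|v t|))).
  exact: (integrableD _ (L1_integrable_norm u1) (L1_integrable_norm v1)).
apply: le_lt_trans; apply: ge0_le_integral => //.
- apply/measurable_EFinP; apply: (strongly_measurable_comp uv).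
  exact: norm_continuous.
- by apply: measurableT_comp.
- by move=> t _; rewrite /= lee_fin ger0_norm ?addr_ge0// ler_normB.
Qed.

(** * Volterra kernels and memory terms *)

Lemma kernel_measurable (R : realType) (T t : R) (k : R -> R -> R) :
  kernel_hyp T k -> t \in `[0, T] -> measurable_fun `[0, t] (k t).
Proof.
move=> [/subspace_continuousP kc _]; rewrite in_itv/= => /andP[t0 tT].
apply: subspace_continuous_measurable_fun => //.
apply/subspace_continuousP => s st.
have sT r : r \in `[0, t] -> triangle T (t, r).
  by rewrite /= in_itv/= => /andP[].
(* Continuity holds relative to the triangle; the neighbourhood of [(t, s)] is sliced along
   [r |-> (t, r)], which stays in the triangle for [r] in [[0, t]]. *)
move=> A /(kc _ (sT s st)); rewrite /nbhs/= /within/= => tA.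
case: tA => -[P Q] /= [nP nQ] PQ; apply: filterS nQ => r Qr rt.
apply: (PQ (t, r)); last exact: sT.
by split => //=; exact: nbhs_singleton.
Qed.

Lemma kernel_bound (R : realType) (T : R) (k : R -> R -> R) :
  kernel_hyp T k -> exists2 K, 0 <= K &
    forall t s, s \in `[0, t] -> t \in `[0, T] -> `|k t s| <= K.
Proof.
(* Every real above [M] is a bound; [|M| + 1] is one that is also nonnegative. *)
move=> [_ [M [_ kM]]]; exists (`|M| + 1); first by rewrite addr_ge0.
move=> t s; rewrite !in_itv/= => /andP[s0 st] /andP[t0 tT].
apply: (kM (`|M| + 1) _ (t, s)) => //.
by rewrite (le_lt_trans (ler_norm _))// ltrDl.
Qed.

Lemma bounded_scalar_continuous (R : realType) (V : normedModType R)
    (L : V -> R) (c : R) :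
  scalar L -> (forall x, `|L x| <= c * `|x|) -> continuous L.
Proof.
move=> lin Lc x; apply/cvgrPdist_lt => e e0.
have c0 : 0 < `|c| + 1 by rewrite ltr_wpDl.
near=> y.
rewrite -(scalarB _ _ lin).
apply: (@le_lt_trans _ _ ((`|c| + 1) * `|x - y|)).
  apply: (le_trans (Lc _)); rewrite ler_wpM2r// (le_trans (ler_norm _))//.
  by rewrite lerDl.
rewrite mulrC -ltr_pdivlMr//; near: y.
by apply: cvgr_dist_lt => //; rewrite divr_gt0.
Unshelve. all: by end_near. Qed.

(** The integrand is dominated by a multiple of [|u s|]. This allows the memory integrals of two
    solutions to be subtracted; [L] will be [a ^~ w] or [b w]. *)
Lemma memory_integrable (R : realType) (V : normedModType R) (T t : R)
    (k : R -> R -> R) (S : set V) (u : R -> V) (L : V -> R) (c : R) :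
  kernel_hyp T k -> t \in `[0, T] -> L1 T S u ->
  scalar L -> (forall x, `|L x| <= c * `|x|) ->
  lebesgue_measure.-integrable `[0, t] (EFin \o (fun s => k t s * L (u s))).
Proof.
move=> hk tT u1 lin Lc; have [K K0 kK] := kernel_bound hk.
have sub : `[0, t] `<=` `[0, T].
  by apply: subset_itvl; move: tT; rewrite in_itv/= bnd_simp => /andP[].
have ui : lebesgue_measure.-integrable `[0, t] (EFin \o (fun s => `|u s|)).
  by apply: integrableS (L1_integrable_norm u1).
apply: (le_integrable _ _ _ (integrableZl _ (K * `|c|) ui)) => //.
  apply/measurable_EFinP; apply: measurable_funM; first exact: kernel_measurable hk tT.
  have [_ um _] := u1; apply: measurable_funS sub _ => //.
  apply: (strongly_measurable_comp um).
  exact: bounded_scalar_continuous lin Lc.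
move=> s st; rewrite /= lee_fin !normrM !normr_id -mulrA ler_pM//.
  by rewrite (le_trans (kK _ _ st tT))// ler_norm.
by rewrite (le_trans (Lc _))// ler_wpM2r// ler_norm.
Qed.

(** * Best approximation, Galerkin orthogonality and quasi-optimality *)

Lemma L1_0 (R : realType) (V : normedModType R) (T : R) (S : set V) :
  S 0 -> L1 T S (fun=> 0).
Proof.
move=> S0; split => //.
  exists (fun _ _ => 0); split.
    move=> _; split => //.
      by apply: sub_finite_set (finite_set1 0) => _ [t _ <-].
    move=> x; have [->|/eqP x0] := eqVneq x 0.
      by rewrite (_ : _ @^-1` _ = setT)//; apply/seteqP; split.
    rewrite (_ : _ @^-1` _ = set0)//; apply/seteqP; split => // t /= /esym.
    by move/x0.
  by move=> t _; rewrite subrr normr0; exact: cvg_cst.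
rewrite /L1norm; under eq_integral do rewrite normr0.
by rewrite integral0 ltry.
Qed.

Lemma L1distE (R : realType) (V : normedModType R) (T : R) (S S' : set V)
    (u v : R -> V) :
  L1 T S u -> L1 T S' v ->
  L1dist T u v = (\int[lebesgue_measure]_(t in `[0, T]) `|u t - v t|)%:E.
Proof.
move=> u1 v1; rewrite /L1dist /L1norm /Rintegral fineK//.
apply: integrable_fin_num => //.
exact: L1_integrable_norm (L1B u1 v1).
Qed.

(** The infima are taken one at a time, with the other term moved across the inequality. This needs
    finite terms; [ereal_inf A] is finite because it lies between 0 and a finite member of [A]. *)
Lemma le_ereal_infD (R : realType) (A B : set \bar R) (x : \bar R) :
  A !=set0 -> B !=set0 ->
  (forall y, A y -> y \is a fin_num /\ (0 <= y)%E) ->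
  (forall z, B z -> z \is a fin_num /\ (0 <= z)%E) ->
  (forall y z, A y -> B z -> (x <= y + z)%E) ->
  (x <= ereal_inf A + ereal_inf B)%E.
Proof.
move=> [y0 Ay0] [z0 Bz0] Af Bf xAB.
have iA : ereal_inf A \is a fin_num.
  rewrite ge0_fin_numE; last by apply/ereal_infP => y /Af[].
  apply: (@le_lt_trans _ _ y0); first exact: ereal_inf_lbound.
  by have [yf _] := Af _ Ay0; rewrite ltey_eq yf.
rewrite addeC -leeBlDr//; apply/ereal_infP => z Bz.
rewrite leeBlDr// addeC -leeBlDr; last by have [] := Bf _ Bz.
apply/ereal_infP => y Ay; rewrite leeBlDr; last by have [] := Bf _ Bz.
exact: xAB.
Qed.

Lemma biscalar_bounded (R : realType) (V Q : hilbertType R)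
    (b : {bilinear V -> Q -> R | *%R & *%R}) :
  continuous (fun z : V * Q => b z.1 z.2) ->
  exists2 k, 0 < k & forall v q, `|b v q| <= k * `|v| * `|q|.
Proof. exact: (@bilinear_schwarz R V Q R^o b). Qed.

(** Against discrete test functions [f] and [g] cancel. The first equation keeps only the memory of
    the error, bounded through the kernels and the forms, and the second, which has no memory, holds
    exactly. The constant [c] precedes the spaces and [lambda], hence is uniform in them. *)
Lemma galerkin_orthogonality (R : realType) (V Q : hilbertType R) (T : R)
    (a : {bilinear V -> V -> R | *%R & *%R})
    (b : {bilinear V -> Q -> R | *%R & *%R}) (k1 k2 : R -> R -> R) :
  continuous (fun z : V * V => a z.1 z.2) ->
  continuous (fun z : V * Q => b z.1 z.2) ->
  kernel_hyp T k1 -> kernel_hyp T k2 ->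
  exists2 c, 0 <= c & forall (S : set V) (M : set Q) lambda f g u p uh ph,
    S 0 -> M 0 ->
    volterra_solution T a b k1 k2 lambda f g setT setT u p ->
    volterra_solution T a b k1 k2 lambda f g S M uh ph ->
    {ae lebesgue_measure, forall t : R, t \in `[0, T] ->
      (forall w, S w -> `|a (uh t - u t) w + b w (ph t - p t)| <=
        c * (\int[lebesgue_measure]_(s in `[0, t])
               (`|uh s - u s| + `|ph s - p s|)) * `|w|) /\
      (forall r, M r -> b (uh t - u t) r = lambda * inner (ph t - p t) r)}.
Proof.
move=> /biscalar_bounded[ma ma0 ha] /biscalar_bounded[mb mb0 hb] hk1 hk2.
have [K1 K10 k1K] := kernel_bound hk1.
have [K2 K20 k2K] := kernel_bound hk2.
exists (K1 * ma + K2 * mb).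
  by rewrite addr_ge0// mulr_ge0// ltW.
move=> S M lambda f g u p uh ph S0 M0 [u1 p1 eq1] [uh1 ph1 eqh].
apply: filterS2 eq1 eqh; first exact: (ae_filter_ringOfSetsType lebesgue_measure).
move=> t eq eqh tT.
split; last first.
  (* Both equations are quantified over a pair of test functions; zero fills the other component. *)
  move=> r Mr; have [_ e2] := eqh tT 0 r S0 Mr; have [_ e1] := eq tT 0 r I I.
  rewrite linearBl (scalarB _ _ (inner_scalar r)) mulrBr.
  move: e1 e2; lra.
move=> w Sw.
have [] := eqh tT w 0 Sw M0; have [] := eq tT w 0 I I.
have a1 v : scalar (a^~ v) by move=> k x y; rewrite linearPl.
have b1 v : scalar (b v) by move=> k x y; rewrite linearPr.
have la v : `|a v w| <= ma * `|w| * `|v| by rewrite (le_trans (ha _ _))// mulrAC.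
have lb q : `|b w q| <= mb * `|w| * `|q| by [].
have integ S' M' u' p' : L1 T S' u' -> L1 T M' p' ->
    lebesgue_measure.-integrable `[0, t]
      (EFin \o (fun s => k1 t s * a (u' s) w + k2 t s * b w (p' s))).
  move=> u'1 p'1.
  exact: (integrableD _ (memory_integrable hk1 tT u'1 (a1 w) la)
    (memory_integrable hk2 tT p'1 (b1 w) lb)).
move=> e1 _ e2 _.
have -> : a (uh t - u t) w + b w (ph t - p t) =
    \int[lebesgue_measure]_(s in `[0, t])
      (k1 t s * a (uh s - u s) w + k2 t s * b w (ph s - p s)).
  rewrite linearBl linearBr addrACA -opprD e1 e2 opprD addrACA subrr add0r.
  rewrite -RintegralB//; [|exact: integ uh1 ph1|exact: integ u1 p1].
  apply: eq_Rintegral => s _; rewrite (linearBl a w) (linearBr b w) !mulrBr.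
  by rewrite opprD addrACA.
have eu := L1B uh1 u1; have ep := L1B ph1 p1.
have int_eT : lebesgue_measure.-integrable `[0, T]
    (EFin \o (fun s => `|uh s - u s| + `|ph s - p s|)).
  exact: (integrableD _ (L1_integrable_norm eu) (L1_integrable_norm ep)).
have int_e : lebesgue_measure.-integrable `[0, t]
    (EFin \o (fun s => `|uh s - u s| + `|ph s - p s|)).
  apply: integrableS int_eT => //.
  by apply: subset_itvl; move: tT; rewrite in_itv/= bnd_simp => /andP[].
rewrite (le_trans (le_normr_Rintegral _ (integ _ _ _ _ eu ep)))//.
rewrite mulrAC -RintegralZl//; apply: le_Rintegral => //.
- exact: (integrable_norm (integ _ _ _ _ eu ep)).
- exact: (integrableZl _ _ int_e).
- move=> s st; rewrite (le_trans (ler_normD _ _))// !normrM.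
  have := ler_pM (normr_ge0 _) (normr_ge0 _) (k1K _ _ st tT) (la (uh s - u s)).
  have := ler_pM (normr_ge0 _) (normr_ge0 _) (k2K _ _ st tT) (lb (ph s - p s)).
  have := mulr_ge0 (mulr_ge0 (mulr_ge0 K10 (ltW ma0)) (normr_ge0 w))
    (normr_ge0 (ph s - p s)).
  have := mulr_ge0 (mulr_ge0 (mulr_ge0 K20 (ltW mb0)) (normr_ge0 w))
    (normr_ge0 (uh s - u s)).
  lra.
Qed.

Lemma quasi_optimality (R : realType) (V Q : hilbertType R) (T : R)
    (a : {bilinear V -> V -> R | *%R & *%R})
    (b : {bilinear V -> Q -> R | *%R & *%R}) (k1 k2 : R -> R -> R)
    (alpha beta lmax : R) : 0 <= T ->
  continuous (fun z : V * V => a z.1 z.2) ->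
  continuous (fun z : V * Q => b z.1 z.2) ->
  (forall v w, a v w = a w v) -> (forall v, 0 <= a v v) ->
  kernel_hyp T k1 -> kernel_hyp T k2 ->
  0 < alpha -> 0 < beta -> 0 < lmax ->
  exists2 C, 0 < C & forall (S : set V) (M : set Q) lambda f g u p uh ph,
    finite_dim_subspace S -> finite_dim_subspace M ->
    coercive_on a (form_ker b S M) alpha -> inf_sup b S M beta ->
    0 < lambda <= lmax ->
    volterra_solution T a b k1 k2 lambda f g setT setT u p ->
    volterra_solution T a b k1 k2 lambda f g S M uh ph ->
    (L1dist T uh u + L1dist T ph p <=
       C%:E * (best_approx T S u + best_approx T M p))%E.
Proof.
move=> T0 ac bc asym apsd hk1 hk2 alpha0 beta0 lmax0.
have [ma ma0 ha] := biscalar_bounded ac.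
have [mb mb0 hb] := biscalar_bounded bc.
have [c c0 galerkin] := galerkin_orthogonality ac bc hk1 hk2.
have [|Cs Cs0 stab] := @saddle_point_stability _ _ _ a b (Num.sqrt ma) _ _ _
  asym apsd (sqrtr_ge0 _) _ alpha0 beta0 lmax0.
  move=> v; rewrite sqr_sqrtr; last exact: ltW.
  by rewrite (le_trans (ler_norm _))// expr2 mulrA ha.
(* This dominates [Cs] times each coefficient of [|u - v|], [|p - q|] and the memory integral in the
   stability estimate; it serves both as the factor on the data and as the Gronwall coefficient. *)
pose B := Cs * (ma + mb + lmax + mb + c).
have B0 : 0 <= B by rewrite mulr_ge0 ?addr_ge0// ltW.
have [Cg Cg0 gronwall] := gronwall_L1 T0 B0.
exists (Cg * (1 + B)); first by rewrite mulr_gt0// ltr_wpDr.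
move=> S M lambda f g u p uh ph Sfin Mfin acoer bSM ll solp solh.
have /andP[l0 llm] := ll.
have orth := galerkin _ _ _ _ _ _ _ _ _ (finite_dim_subspace0 Sfin)
  (finite_dim_subspace0 Mfin) solp solh.
have [u1 p1 _] := solp; have [uh1 ph1 _] := solh.
set E := fun t => `|uh t - u t| + `|ph t - p t|.
have Ei : lebesgue_measure.-integrable `[0, T] (EFin \o E).
  exact: (integrableD _ (L1_integrable_norm (L1B uh1 u1))
                        (L1_integrable_norm (L1B ph1 p1))).
have main v q : L1 T S v -> L1 T M q ->
    (L1dist T uh u + L1dist T ph p <=
      (Cg * (1 + B))%:E * (L1dist T u v + L1dist T p q))%E.
  move=> v1 q1.
  pose D := fun t => `|u t - v t| + `|p t - q t|.
  have Dui := L1_integrable_norm (L1B u1 v1).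
  have Dpi := L1_integrable_norm (L1B p1 q1).
  have Di : lebesgue_measure.-integrable `[0, T] (EFin \o D).
    exact: (integrableD _ Dui Dpi).
  rewrite (L1distE uh1 u1) (L1distE ph1 p1) (L1distE u1 v1) (L1distE p1 q1).
  rewrite -!EFinD -EFinM lee_fin -!RintegralD//; last 2 first.
  - exact: L1_integrable_norm (L1B uh1 u1).
  - exact: L1_integrable_norm (L1B ph1 p1).
  rewrite -mulrA -[(1 + B) * _]RintegralZl//.
  apply: gronwall => //.
  - exact: (integrableZl _ (1 + B) Di).
  - by move=> t _; apply: mulr_ge0; rewrite addr_ge0.
  apply: filterS orth; first exact: (ae_filter_ringOfSetsType lebesgue_measure).
  move=> t orth tT; have [orthV orthQ] := orth tT.
  set I := \int[lebesgue_measure]_(s in _) _ in orthV *.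
  have I0 : 0 <= I by apply: Rintegral_ge0 => s _; rewrite addr_ge0.
  have [uS _ _] := uh1; have [vS _ _] := v1.
  have [pM _ _] := ph1; have [qM _ _] := q1.
  (* The pair [(uh - v, ph - q)] is discrete. Its residuals are those of the error, controlled by
     [orth], plus those of [(u - v, p - q)], controlled by continuity of the forms and
     [lambda <= lmax]. *)
  have := stab S M lambda
    (ma * `|u t - v t| + mb * `|p t - q t| + c * I)
    (mb * `|u t - v t| + lmax * `|p t - q t|) (uh t - v t) (ph t - q t).
  move=> /(_ Sfin Mfin acoer bSM ll).
  have F0 : 0 <= ma * `|u t - v t| + mb * `|p t - q t| + c * I.
    by rewrite !addr_ge0// mulr_ge0// ltW.
  have G0 : 0 <= mb * `|u t - v t| + lmax * `|p t - q t|.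
    by rewrite !addr_ge0// mulr_ge0// ltW.
  move=> /(_ F0 G0 (finite_dim_subspaceB Sfin (uS _ tT) (vS _ tT))
                   (finite_dim_subspaceB Mfin (pM _ tT) (qM _ tT))).
  have ue : uh t - v t = (uh t - u t) + (u t - v t) by rewrite addrA subrK.
  have pe : ph t - q t = (ph t - p t) + (p t - q t) by rewrite addrA subrK.
  move=> h.
  have {}h : `|uh t - v t| + `|ph t - q t| <= Cs *
      (ma * `|u t - v t| + mb * `|p t - q t| + c * I +
       (mb * `|u t - v t| + lmax * `|p t - q t|)).
    apply: h => [w Sw|r Mr].
      rewrite ue pe linearDl linearDr addrACA.
      have := orthV w Sw; have := ha (u t - v t) w; have := hb w (p t - q t).
      rewrite !ler_norml => /andP[? ?] /andP[? ?] /andP[? ?]; lra.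
    have iD : inner (ph t - q t) r = inner (ph t - p t) r + inner (p t - q t) r.
      by have := inner_scalar r 1 (ph t - p t) (p t - q t); rewrite scale1r mul1r -pe.
    rewrite iD ue linearDl/= orthQ// mulrDr opprD addrACA subrr add0r.
    rewrite (le_trans (ler_normB _ _))// mulrDl lerD// normrM gtr0_norm// -mulrA.
    by rewrite ler_pM// ?inner_le_norm// ltW.
  have e1 : `|uh t - u t| <= `|uh t - v t| + `|u t - v t|.
    rewrite [uh t - u t](_ : _ = (uh t - v t) - (u t - v t)) ?ler_normB//.
    by rewrite opprB addrA subrK.
  have e2 : `|ph t - p t| <= `|ph t - q t| + `|p t - q t|.
    rewrite [ph t - p t](_ : _ = (ph t - q t) - (p t - q t)) ?ler_normB//.
    by rewrite opprB addrA subrK.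
  have d1 : 0 <= `|u t - v t| by [].
  have d2 : 0 <= `|p t - q t| by [].
  rewrite /E /D /B.
  move: (`|u t - v t|) (`|p t - q t|) (`|uh t - v t|) (`|ph t - q t|)
    (`|uh t - u t|) (`|ph t - p t|) h e1 e2 d1 d2.
  move=> d1 d2 x1 x2 y1 y2 h e1 e2 d10 d20.
  (* These nine products are exactly the surplus of [B * (d1 + d2 + I)] over the bound in [h]. *)
  have h1 : 0 <= Cs * (ma * d2) by rewrite !mulr_ge0// ltW.
  have h2 : 0 <= Cs * (mb * d2) by rewrite !mulr_ge0// ltW.
  have h3 : 0 <= Cs * (lmax * d1) by rewrite !mulr_ge0// ltW.
  have h9 : 0 <= Cs * (mb * d1) by rewrite !mulr_ge0// ltW.
  have h4 : 0 <= Cs * (c * d1) by rewrite !mulr_ge0// ltW.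
  have h5 : 0 <= Cs * (c * d2) by rewrite !mulr_ge0// ltW.
  have h6 : 0 <= Cs * (ma * I) by rewrite !mulr_ge0// ltW.
  have h7 : 0 <= Cs * (mb * I) by rewrite !mulr_ge0// ltW.
  have h8 : 0 <= Cs * (lmax * I) by rewrite !mulr_ge0// ltW.
  lra.
have C0 : 0 < Cg * (1 + B) by rewrite mulr_gt0// ltr_wpDr.
(* With the constant on the left, the right-hand side is a bare sum of two infima over independent
   [v] and [q]. *)
rewrite -lee_pdivrMl//.
have fin (W : normedModType R) (N : set W) (z : R -> W) : L1 T setT z ->
    forall y, [set L1dist T z w | w in L1 T N] y ->
    y \is a fin_num /\ (0 <= y)%E.
  move=> z1 _ [w w1 <-]; rewrite (L1distE z1 w1); split => //.
  by rewrite lee_fin Rintegral_ge0.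
apply: le_ereal_infD.
- by exists (L1dist T u (fun=> 0)); exists (fun=> 0) => //;
    exact: L1_0 (finite_dim_subspace0 Sfin).
- by exists (L1dist T p (fun=> 0)); exists (fun=> 0) => //;
    exact: L1_0 (finite_dim_subspace0 Mfin).
- exact: fin.
- exact: fin.
- move=> _ _ [v v1 <-] [q q1 <-]; rewrite lee_pdivrMl//.
  exact: main.
Qed.

(** The type [H] indexes the discretizations, and all constants are chosen before [h]. Uniformity in
    [lambda] means that one constant serves all [lambda] in []0, lambda_max]]. *)
Theorem theorem2p9 (R : realType) (V Q : hilbertType R) (T : R) (hT : 0 <= T)
    (a : {bilinear V -> V -> R | *%R & *%R})
    (b : {bilinear V -> Q -> R | *%R & *%R})
    (a_cont : continuous (fun z : V * V => a z.1 z.2))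
    (b_cont : continuous (fun z : V * Q => b z.1 z.2))
    (a_sym : forall v w, a v w = a w v)
    (a_psd : forall v, 0 <= a v v)
    (a_coercive : exists2 alpha : R,
       0 < alpha & coercive_on a (form_ker b setT setT) alpha)
    (k1 k2 : R -> R -> R) (hk1 : kernel_hyp T k1) (hk2 : kernel_hyp T k2)
    (H : Type) (Vh : H -> set V) (Qh : H -> set Q)
    (Vh_fin : forall h, finite_dim_subspace (Vh h))
    (Qh_fin : forall h, finite_dim_subspace (Qh h))
    (alpha0 : R) (alpha0_gt0 : 0 < alpha0)
    (a_coercive_h : forall h, coercive_on a (form_ker b (Vh h) (Qh h)) alpha0)
    (beta : R) (beta_gt0 : 0 < beta)
    (b_inf_sup : forall h, inf_sup b (Vh h) (Qh h) beta) :
  exists C1u C1p C2u C2p : R -> R,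
    (forall lambda : R, 0 < lambda ->
      [/\ 0 < C1u lambda, 0 < C1p lambda, 0 < C2u lambda & 0 < C2p lambda]) /\
    (forall (lambda : R) h f g u p uh ph, 0 < lambda ->
      L1dual T f -> L1dual T g ->
      volterra_solution T a b k1 k2 lambda f g setT setT u p ->
      volterra_solution T a b k1 k2 lambda f g (Vh h) (Qh h) uh ph ->
      (L1dist T uh u <= (C1u lambda)%:E * best_approx T (Vh h) u
                      + (C1p lambda)%:E * best_approx T (Qh h) p)%E /\
      (L1dist T ph p <= (C2u lambda)%:E * best_approx T (Vh h) u
                      + (C2p lambda)%:E * best_approx T (Qh h) p)%E) /\
    (forall lambda_max : R, 0 < lambda_max ->
      exists2 C : R, 0 < C &
        forall (lambda : R) h f g u p uh ph, 0 < lambda -> lambda <= lambda_max ->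
        L1dual T f -> L1dual T g ->
        volterra_solution T a b k1 k2 lambda f g setT setT u p ->
        volterra_solution T a b k1 k2 lambda f g (Vh h) (Qh h) uh ph ->
        (L1dist T uh u + L1dist T ph p <=
          C%:E * (best_approx T (Vh h) u + best_approx T (Qh h) p))%E).
Proof.
(* The condition [0 < lmax] sits under the existential so that [C] is a total function of [lmax];
   its value 0 at nonpositive arguments is a default. *)
have /choice[C CP] : forall lmax : R, exists C : R, 0 < lmax -> 0 < C /\
    forall (lambda : R) h f g u p uh ph, 0 < lambda -> lambda <= lmax ->
    volterra_solution T a b k1 k2 lambda f g setT setT u p ->
    volterra_solution T a b k1 k2 lambda f g (Vh h) (Qh h) uh ph ->
    (L1dist T uh u + L1dist T ph p <=
      C%:E * (best_approx T (Vh h) u + best_approx T (Qh h) p))%E.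
  move=> lmax; have [l0|l0] := ltP 0 lmax; last first.
    by exists 0.
  have [C C0 CP] := quasi_optimality hT a_cont b_cont a_sym a_psd hk1 hk2
    alpha0_gt0 beta_gt0 l0.
  exists C => _; split=> // lambda h f g u p uh ph lambda0 llmax.
  by apply: CP => //; rewrite lambda0.
(* Taking [lmax] to be [lambda] itself, the estimate for the sum bounds each of its nonnegative
   terms. *)
exists C, C, C, C; split; first by move=> l /CP[C0 _].
split=> [lambda h f g u p uh ph l0 _ _ solp solh|lmax lmax0]; last first.
  have [C0 {}CP] := CP _ lmax0; exists (C lmax) => // lambda h f g u p uh ph.
  by move=> *; apply: CP; eassumption.
have [_ /(_ lambda h f g u p uh ph l0 (lexx _) solp solh)] := CP _ l0.
have dist0 (W : normedModType R) (z w : R -> W) : (0 <= L1dist T z w)%E.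
  by apply: integral_ge0 => t _; rewrite lee_fin.
have approx0 (W : normedModType R) (N : set W) (z : R -> W) :
    (0 <= best_approx T N z)%E.
  by apply/ereal_infP => _ [w _ <-].
rewrite ge0_muleDr// => est; split; apply: le_trans est.
  by rewrite leeDl.
by rewrite leeDr.
Qed.
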